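(* Let $L_n$ be the ladder graph, i.e. the Cartesian product $P_2\times P_n$ of a path with $2$ vertices and a path with $n$ vertices (so $L_n$ has $2n$ vertices and $3n-2$ edges; $L_1=P_2$ and $L_2$ is the $4$-cycle). Then $C(L_1)=2$, $C(L_2)=12$, and for all $n>2$, \[C(L_n)=6\cdot C(L_{n-1})+C(L_{n-2}).\]
   Context: For a finite labelled graph $G$, a composition of $G$ is a partition of the vertex set $V(G)$ into nonempty blocks such that each block induces a connected subgraph of $G$. $C(G)$ denotes the number of distinct compositions of $G$. *)

(* Defs.v *)
From mathcomp Require Import all_boot.

Set Implicit Arguments.
Unset Strict Implicit.
Unset Printing Implicit Defensive.

Record sgraph := SGraph {
  vertex :> finType;
  adj : rel vertex;
  adj_sym : symmetric adj;
  adj_irrefl : irreflexive adj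
}.

Section Induced.
Variables (G : sgraph) (B : {set G}).

Definition induced_adj : rel {x : G | x \in B} :=
  [rel x y | adj (val x) (val y)].

Fact induced_adj_sym : symmetric induced_adj.
Proof. by move=> x y; apply: adj_sym. Qed.

Fact induced_adj_irrefl : irreflexive induced_adj.
Proof. by move=> x; apply: adj_irrefl. Qed.

Definition induced : sgraph := SGraph induced_adj_sym induced_adj_irrefl.

End Induced.

(* The graph without vertices counts as connected here; this is harmless
   below, since [partition] already excludes empty blocks. *)
Definition graph_connected (G : sgraph) : bool :=
  [forall x : G, forall y : G, connect (@adj G) x y].

Definition is_composition (G : sgraph) (P : {set {set G}}) : bool :=
  partition P [set: G] && [forall B in P, graph_connected (induced B)].

Definition num_compositions (G : sgraph) : nat :=
  #|[set P : {set {set G}} | is_composition P]|.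

Section Path.
Variable n : nat.

Definition path_adj : rel 'I_n :=
  [rel i j : 'I_n | (i.+1 == j :> nat) || (j.+1 == i :> nat)].

Fact path_adj_sym : symmetric path_adj.
Proof. by move=> i j; rewrite /path_adj /= orbC. Qed.

Fact path_adj_irrefl : irreflexive path_adj.
Proof. by move=> i; rewrite /path_adj /= orbb eqn_leq ltnn. Qed.

Definition path_graph : sgraph := SGraph path_adj_sym path_adj_irrefl.

End Path.

Section CartesianProduct.
Variables G H : sgraph.

Definition cart_adj : rel (G * H) :=
  [rel u v | (u.1 == v.1) && adj u.2 v.2 || (u.2 == v.2) && adj u.1 v.1].

Fact cart_adj_sym : symmetric cart_adj.
Proof.
move=> u v; rewrite /cart_adj /= (adj_sym u.2) (adj_sym u.1).
by rewrite (eq_sym u.1) (eq_sym u.2).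
Qed.

Fact cart_adj_irrefl : irreflexive cart_adj.
Proof. by move=> u; rewrite /cart_adj /= !adj_irrefl !andbF. Qed.

Definition cart_prod : sgraph := SGraph cart_adj_sym cart_adj_irrefl.

End CartesianProduct.

Definition ladder (n : nat) : sgraph := cart_prod (path_graph 2) (path_graph n).

(* Main.v *)
Require Import Defs.
From mathcomp Require Import all_boot zify.

Set Implicit Arguments.
Unset Strict Implicit.
Unset Printing Implicit Defensive.

(** A composition is determined by the set of edges that lie inside its blocks,
    and an edge set arises in this way as soon as some vertex colouring makes
    it the set of monochromatic edges. For a ladder, colouring the columns from
    left to right shows that the only condition is local: no square has exactly
    three of its four sides in the set. So compositions correspond to walks on
    the columns, whose state is whether the last rung is in the set; the
    transfer matrix [[2, 3], [3, 4]] has trace 6 and determinant -1. *)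

(** * Compositions and monochromatic edges *)

Definition same_block (G : finType) (P : {set {set G}}) (x y : G) : bool :=
  pblock P x == pblock P y.

Definition mono_adj (G : sgraph) (T : eqType) (c : G -> T) : rel G :=
  [rel x y | adj x y && (c x == c y)].

Lemma mono_connect_eq (G : sgraph) (T : eqType) (c : G -> T) (x y : G) :
  connect (mono_adj c) x y -> c x = c y.
Proof.
case/connectP=> p; elim: p x => [|z p IHp] x /=; first by move=> _ ->.
by case/andP=> /andP[_ /eqP ->]; apply: IHp.
Qed.

Lemma mono_adj_sym (G : sgraph) (T : eqType) (c : G -> T) :
  symmetric (mono_adj c).
Proof. by move=> x y; rewrite /mono_adj /= adj_sym eq_sym. Qed.

Lemma connect_induced (G : sgraph) (B : {set G}) (x y : induced B) :
  connect (@adj (induced B)) x y ->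
  connect [rel u v | [&& @adj G u v, u \in B & v \in B]] (val x) (val y).
Proof.
case/connectP=> p; elim: p x => [|z p IHp] x /=; first by move=> _ ->; apply: connect0.
case/andP=> xz zp ey; apply: connect_trans (IHp z zp ey); apply: connect1.
by apply/and3P; split; [exact: xz | exact: valP | exact: valP].
Qed.

(** Closure of [B] under [r] keeps the whole walk inside [B], so each of its vertices lifts to the
    subtype. *)
Lemma induced_connect (G : sgraph) (r : rel G) (B : {set G}) (x y : induced B) :
  subrel r (@adj G) -> (forall u v, u \in B -> r u v -> v \in B) ->
  connect r (val x) (val y) -> connect (@adj (induced B)) x y.
Proof.
move=> sub_r closedB /connectP[p].
elim: p x => [|z p IHp] x /=.
  by move=> _ eyx; rewrite (val_inj eyx); apply: connect0.
case/andP=> xz zp ey; have zB := closedB _ _ (valP x) xz.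
apply: connect_trans (IHp (exist _ z zB) zp ey); apply: connect1.
exact: sub_r.
Qed.

(** Blocks are connected, so two vertices of a block are joined by a walk inside it; conversely a
    walk along edges inside blocks never changes block. *)
Lemma composition_blocksP (G : sgraph) (P : {set {set G}}) :
  is_composition P ->
  (fun x y => y \in pblock P x) =2 connect (mono_adj (pblock P)).
Proof.
case/andP=> partP /forall_inP connP x y.
have [/eqP covP trivP _] := and3P partP.
have inP z : z \in cover P by rewrite covP inE.
apply/idP/idP=> [yx | /mono_connect_eq/eqP]; last by rewrite eq_pblock.
have xx : x \in pblock P x by rewrite mem_pblock.
have /forallP/(_ (exist _ x xx))/forallP/(_ (exist _ y yx)) :=
  connP _ (pblock_mem (inP x)).
move/connect_induced; apply: connect_sub => u v /= /and3P[uv ux vx].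
apply: connect1; rewrite /mono_adj /= uv.
by rewrite (same_pblock trivP ux) -(same_pblock trivP vx) eqxx.
Qed.

Lemma composition_inj (G : sgraph) (P Q : {set {set G}}) :
  is_composition P -> is_composition Q ->
  (forall x y : G, adj x y -> same_block P x y = same_block Q x y) -> P = Q.
Proof.
move=> compP compQ eqPQ.
have [partP _] := andP compP; have [partQ _] := andP compQ.
rewrite -(equivalence_partition_pblock partP).
rewrite -(equivalence_partition_pblock partQ).
have eqc : mono_adj (pblock P) =2 mono_adj (pblock Q).
  move=> x y; rewrite /mono_adj /=; case xy: (adj x y) => //=.
  exact: eqPQ.
have eqR x y : (y \in pblock P x) = (y \in pblock Q x).
  by rewrite (composition_blocksP compP) (composition_blocksP compQ)
             (eq_connect eqc).
by apply: eq_imset => x; apply/setP=> y; rewrite !inE eqR.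
Qed.

(** The blocks are the components of the monochromatic edges. A colour may occur in several blocks,
    but adjacent vertices of equal colour always share one. *)
Lemma composition_of_colouring (G : sgraph) (T : eqType) (c : G -> T) :
  exists2 P : {set {set G}}, is_composition P &
    forall x y : G, adj x y -> same_block P x y = (c x == c y).
Proof.
pose R := connect (mono_adj c); pose P := equivalence_partition R [set: G].
have symR : connect_sym (mono_adj c).
  by apply: sym_connect_sym; apply: mono_adj_sym.
have eqR : {in [set: G] & &, equivalence_rel R}.
  move=> x y z _ _ _; split; first exact: connect0.
  by move=> xy; apply: same_connect.
have partP : partition P [set: G] by apply: equivalence_partitionP.
have [/eqP covP trivP _] := and3P partP.
have pbP x y : same_block P x y = R x y.
  by rewrite /same_block eq_pblock ?covP ?inE // pblock_equivalence_partition ?inE.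
exists P => [|x y xy].
  rewrite /is_composition partP; apply/forall_inP=> _ /imsetP[x0 _ ->].
  apply/forallP=> x; apply/forallP=> y.
  apply: (@induced_connect _ (mono_adj c)).
  - by move=> u v /andP[].
  - move=> u v; rewrite !inE /= => x0u uv.
    exact: connect_trans x0u (connect1 uv).
  - have := valP x; have := valP y; rewrite !inE /= => x0y x0x.
    by apply: connect_trans x0y; rewrite symR.
rewrite pbP; apply/idP/idP=> [/mono_connect_eq/eqP // | cxy].
by apply: connect1; rewrite /mono_adj /= xy.
Qed.

(** * Words of ladder compositions *)

(* A letter records which of the three edges added together with a column are
   selected: the upper rail edge, the lower rail edge and the new rung. *)
Definition letter : finType := (bool * bool * bool)%type.

(** The sides of the square between two columns are the old rung and the three new edges; the rails
    of [x] belong to the preceding square. *)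
Definition square_ok (x y : letter) : bool :=
  count id [:: x.2; y.1.1; y.1.2; y.2] != 3.

(** By transitivity, three equalities around a square force the fourth. *)
Lemma square_colours (T : eqType) (a b a' b' : T) (u : bool * bool) :
  square_ok (u, a == b) (a == a', b == b', a' == b').
Proof.
rewrite /square_ok /=.
case: (a =P b); case: (a =P a'); case: (b =P b'); case: (a' =P b') => //=;
  congruence.
Qed.

(* All colours in use are below k, so k and k.+1 are fresh. *)
Lemma extend_colours (k a b : nat) (x y : letter) :
    a < k -> b < k -> (a == b) = x.2 -> square_ok x y ->
  exists a' b', [/\ a' < k.+2, b' < k.+2 & y = (a == a', b == b', a' == b')].
Proof.
move=> ak bk; case: x => u v; case: y => [[t h] w] /= <-; rewrite /square_ok /=.
have ltk c : c < k -> [/\ c < k.+2, (c == k) = false & (c == k.+1) = false].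
  by move=> ck; rewrite !ltn_eqF ?ltnS // ltnW // ltnW.
have [ak2 ak0 ak1] := ltk a ak; have [bk2 bk0 bk1] := ltk b bk.
(* A selected edge forces its new end to copy a colour; an end with nothing to copy gets a fresh
   colour, [k] above and [k.+1] below. *)
move=> ok_sq; pose a' := if t then a else if w && h then b else k.
exists a', (if h then b else if w then a' else k.+1); rewrite /a'; move: ok_sq.
case: t h w {a'} => [] [] []; case: (eqVneq a b) => [eab|/negbTE nab] //= _;
  split; rewrite ?(ltn_eqF (ltnSn k)) ?(eqxx, ak0, ak1, bk0, bk1, nab) //.
all: by rewrite ?eab ?(eq_sym k b) ?(eqxx, bk0, bk1).
Qed.

(** Induction along the columns: only the colours [a], [b] of the last column matter, and the bound
    [k] grows by two at each column. *)
Lemma word_colouring (s : seq letter) (x : letter) (k a b : nat) :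
    a < k -> b < k -> (a == b) = x.2 -> path square_ok x s ->
  exists c : nat -> nat * nat, c 0 = (a, b) /\
    forall i, i < size s ->
      nth x s i = ((c i).1 == (c i.+1).1, (c i).2 == (c i.+1).2,
                   (c i.+1).1 == (c i.+1).2).
Proof.
elim: s x k a b => [|y s IHs] x k a b ak bk abx /=; first by exists (fun=> (a, b)).
case/andP=> xy ys.
have [a' [b' [ak' bk' ey]]] := extend_colours ak bk abx xy.
have aby' : (a' == b') = y.2 by rewrite ey.
have [c [c0 cs]] := IHs y k.+2 a' b' ak' bk' aby' ys.
exists (fun i => if i is j.+1 then c j else (a, b)); split=> // [[|i]] /= isz.
  by rewrite c0 /=.
by rewrite -cs // (set_nth_default y).
Qed.

(** Coordinates are plain numbers, so that [i.+1] needs no bound proof; they are meaningful for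
    [r < 2] and [i <= n]. *)
Definition cell (n : nat) (r i : nat) : ladder n.+1 :=
  (inord r : 'I_2, inord i : 'I_n.+1).

(** Each of the [3 * n + 1] edges is read exactly once, the leftmost rung separately because no
    rails precede it. *)
Definition word (n : nat) (R : rel (ladder n.+1)) : bool * n.-tuple letter :=
  (R (cell n 0 0) (cell n 1 0),
   [tuple (R (cell n 0 i) (cell n 0 i.+1), R (cell n 1 i) (cell n 1 i.+1),
           R (cell n 0 i.+1) (cell n 1 i.+1)) | i < n]).

Lemma cellE (n : nat) (x : ladder n.+1) : x = cell n x.1 x.2.
Proof. by case: x => r i; rewrite /cell /= !inord_val. Qed.

Lemma ladder_rel_eq (n : nat) (R S : rel (ladder n.+1)) :
    symmetric R -> symmetric S ->
    (forall i, i < n.+1 -> R (cell n 0 i) (cell n 1 i) = S (cell n 0 i) (cell n 1 i)) ->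
    (forall r i, r < 2 -> i < n ->
      R (cell n r i) (cell n r i.+1) = S (cell n r i) (cell n r i.+1)) ->
  forall x y, adj x y -> R x y = S x y.
Proof.
move=> symR symS rung rail x y; rewrite (cellE x) (cellE y).
case: x y => [r i] [r' j] /=; rewrite /cart_adj /= !inord_val.
case/orP=> /andP[/eqP <-]; rewrite /path_adj /= => /orP[] /eqP e.
- by rewrite -e; apply: rail => //; rewrite -ltnS e.
- by rewrite -e symR symS; apply: rail => //; rewrite -ltnS e.
- have [-> ->] : r = 0 :> nat /\ r' = 1 :> nat.
    by move: e (ltn_ord r'); case: (r : nat) => [|m] <-.
  exact: rung.
- have [-> ->] : r' = 0 :> nat /\ r = 1 :> nat.
    by move: e (ltn_ord r); case: (r' : nat) => [|m] <-.
  by rewrite symR symS; apply: rung.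
Qed.

Lemma word_inj (n : nat) (R S : rel (ladder n.+1)) :
  symmetric R -> symmetric S -> word R = word S ->
  forall x y, adj x y -> R x y = S x y.
Proof.
move=> symR symS eqw.
have et (i : 'I_n) := congr1 (fun w => tnth w.2 i) eqw.
apply: ladder_rel_eq => // [[|i] lt_in | [|[|r]] i // _ lt_in].
  by case: eqw.
all: by have := et (Ordinal (lt_in : i < n)); rewrite !tnth_mktuple => -[].
Qed.

Lemma adj_rung (n i : nat) : adj (cell n 0 i) (cell n 1 i).
Proof. by apply/orP; right; rewrite /= eqxx /path_adj /= !inordK. Qed.

Lemma adj_rail (n r i : nat) : i < n -> adj (cell n r i) (cell n r i.+1).
Proof.
move=> lt_in; apply/orP; left; rewrite /= eqxx /path_adj /= !inordK ?eqxx //.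
exact: ltnW.
Qed.

Lemma eq_word (n : nat) (R S : rel (ladder n.+1)) :
  (forall x y, adj x y -> R x y = S x y) -> word R = word S.
Proof.
move=> eRS; congr (_, _); first by apply: eRS; apply: adj_rung.
apply: eq_mktuple => i; rewrite !eRS //; first exact: adj_rung.
  by apply: adj_rail.
by apply: adj_rail.
Qed.

(** The two [false] entries are padding for the missing rails before the first column; [square_ok]
    does not read them. *)
Definition good_words (n : nat) : {set bool * n.-tuple letter} :=
  [set w : (bool * n.-tuple letter)%type | path square_ok (false, false, w.1) w.2].

Lemma word_colours_good (n : nat) (T : eqType) (c : ladder n.+1 -> T) :
  word (fun x y => c x == c y) \in good_words n.
Proof.
rewrite inE /=; set s := map _ _; set x := (_, _, _).
have szs : size s = n by rewrite size_map size_enum_ord.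
have nths i : i < n -> nth x s i =
    (c (cell n 0 i) == c (cell n 0 i.+1), c (cell n 1 i) == c (cell n 1 i.+1),
     c (cell n 0 i.+1) == c (cell n 1 i.+1)).
  move=> lt_in; rewrite (nth_map (Ordinal lt_in)) ?size_enum_ord //.
  by rewrite nth_enum_ord.
apply/(pathP x) => -[|i]; rewrite szs => lt_in; rewrite [nth x s _]nths //=.
  exact: square_colours.
by rewrite nths ?(ltnW lt_in) //; apply: square_colours.
Qed.

Lemma good_word_colouring (n : nat) (w : bool * n.-tuple letter) :
  w \in good_words n ->
  exists c : ladder n.+1 -> nat, word (fun x y => c x == c y) = w.
Proof.
case: w => v s; rewrite inE /= => ok_s.
have lt02 : 0 < 2 by [].
(* The first column is coloured 0 and [~~ v], which agree exactly when its rung is selected. *)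
have b2 : ~~ v < 2 by case: v {ok_s}.
have eb : (0 == ~~ v :> nat) = v by case: v {ok_s b2}.
have [c [c0 cs]] := word_colouring lt02 b2 (x := (false, false, v)) eb ok_s.
pose d (x : ladder n.+1) := if x.1 == 0 :> nat then (c x.2).1 else (c x.2).2.
have d0 i : i < n.+1 -> d (cell n 0 i) = (c i).1 by move=> ?; rewrite /d /= !inordK.
have d1 i : i < n.+1 -> d (cell n 1 i) = (c i).2 by move=> ?; rewrite /d /= !inordK.
exists d; congr (_, _); first by rewrite d0 // d1 // c0 /= eb.
apply: eq_from_tnth => i; rewrite tnth_mktuple (tnth_nth (false, false, v)).
have lt_in := ltn_ord i.
by rewrite cs ?size_tuple // !(d0, d1) // ltnW.
Qed.

(** Reading the word of [same_block] is a bijection from compositions to good words: edges determine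
    a composition, and a colouring realises each good word. *)
Lemma num_compositions_ladder (n : nat) :
  num_compositions (ladder n.+1) = #|good_words n|.
Proof.
have symB P : symmetric (@same_block (ladder n.+1) P).
  by move=> x y; rewrite /same_block eq_sym.
rewrite /num_compositions -(@card_in_imset _ _ (fun P => word (same_block P))).
  apply: eq_card => w; apply/imsetP/idP=> [[P _ ->] | ].
    exact: word_colours_good.
  case/good_word_colouring=> c <-.
  have [P compP eqP] := composition_of_colouring c.
  by exists P; rewrite ?inE //; apply/esym/eq_word.
move=> P Q; rewrite !inE => compP compQ eqw.
by apply: composition_inj => // x y; apply: word_inj.
Qed.

(** * Counting words *)

Definition num_words (n : nat) (x : letter) : nat :=
  \sum_(s : n.-tuple letter) path square_ok x s.

Lemma sum_tuple_cons (T : finType) (n : nat) (F : n.+1.-tuple T -> nat) :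
  \sum_s F s = \sum_(x : T) \sum_(s : n.-tuple T) F [tuple of x :: s].
Proof.
rewrite pair_bigA /=.
rewrite (reindex (fun p : T * n.-tuple T => [tuple of p.1 :: p.2])) //=.
exists (fun s : n.+1.-tuple T => (thead s, [tuple of behead s])) => [[x s]|s] _ /=.
  by congr (_, _); apply: val_inj.
by rewrite [RHS]tuple_eta; apply: val_inj.
Qed.

Lemma num_words0 (x : letter) : num_words 0 x = 1.
Proof.
rewrite /num_words (big_pred1 [tuple]) // => s.
by rewrite [s]tuple0; apply/esym/eqP.
Qed.

Lemma num_wordsS (n : nat) (x : letter) :
  num_words n.+1 x = \sum_y square_ok x y * num_words n y.
Proof.
rewrite /num_words sum_tuple_cons; apply: eq_bigr => y _.
by rewrite big_distrr; apply: eq_bigr => s _ /=; rewrite mulnb.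
Qed.

Lemma num_words_rung (n : nat) (x : letter) :
  num_words n x = num_words n (false, false, x.2).
Proof.
case: n => [|n]; first by rewrite !num_words0.
by rewrite !num_wordsS.
Qed.

(** The coefficients count the choices of the two new rails: with [r] of the two rungs selected, the
    number of selected rails must differ from [3 - r], leaving 2, 3 or 4 choices for [r] equal to 2,
    1 or 0. *)
Lemma num_words_step (n : nat) (v : bool) :
  num_words n.+1 (false, false, v) =
    (if v then 2 else 3) * num_words n (false, false, true)
    + (if v then 3 else 4) * num_words n (false, false, false).
Proof.
rewrite num_wordsS.
under eq_bigr => y _ do rewrite num_words_rung.
rewrite -(pair_bigA _ (fun a b => square_ok (false, false, v) (a, b)
                         * num_words n (false, false, b))) /=.
rewrite -(pair_bigA _ (fun a a' => \sum_b square_ok (false, false, v) (a, a', b)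
                         * num_words n (false, false, b))) /=.
rewrite !big_bool /square_ok.
move: (num_words _ _) (num_words _ _) => p q.
by case: v; rewrite /= !(mul0n, mul1n, add0n, addn0); lia.
Qed.

Lemma card_good_words (n : nat) :
  #|good_words n| =
    num_words n (false, false, true) + num_words n (false, false, false).
Proof.
rewrite -sum1dep_card big_mkcond.
rewrite -(pair_bigA _ (fun v s =>
  if path square_ok (false, false, v) (tval s) then 1 else 0)) /= big_bool.
by congr (_ + _); apply: eq_bigr => s _; case: path.
Qed.

Theorem theorem9 :
  [/\ num_compositions (ladder 1) = 2,
      num_compositions (ladder 2) = 12
    & forall n : nat, 2 < n ->
        num_compositions (ladder n) =
          6 * num_compositions (ladder (n - 1)) + num_compositions (ladder (n - 2))].
Proof.
split=> [||[|[|[|n]]] // _].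
- by rewrite num_compositions_ladder card_good_words !num_words0.
- by rewrite num_compositions_ladder card_good_words !num_words_step !num_words0.
(* All terms become linear in the two counts at length [n]; the identity is then Cayley-Hamilton for
   the transfer matrix, [M^2 = 6 M + 1]. *)
rewrite !subSS !subn0 !num_compositions_ladder !card_good_words !num_words_step.
lia.
Qed.
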